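(* Let $q\ge2$ and $k\ge0$ be integers and let $H_{q,k}$ be the hierarchical lattice after $k$ iterations. Then its Kemeny constant $K$, multiplicative degree-Kirchhoff index $\tilde{\mathcal K}$, additive degree-Kirchhoff index $\bar{\mathcal K}$ and Kirchhoff index $\mathcal K$ are as follows. If $q=2$: $$K(H_{2,k})=\frac{(6k+4)4^k+5}{18},\qquad \tilde{\mathcal{K}}(H_{2,k})=\frac{(6k+4)16^{k}+5\cdot4^k}{9},$$ $$\bar{\mathcal{K}}(H_{2,k})=\frac{4(k+1)16^k}{9}+\frac{38\cdot4^k}{27}+\frac{4}{27},\qquad \mathcal{K}(H_{2,k})=\frac{2(5k+7)16^k}{135}+\frac{38\cdot4^k}{81}+\frac{173-60k}{405}.$$ If $q\neq2$: $$K(H_{q,k})=\frac{q(q-1)(2q)^k}{(q-2)(2q-1)}-\frac{q\cdot4^k}{3(q-2)}+\frac{4q-3}{6(2q-1)},$$ $$\tilde{\mathcal{K}}(H_{q,k})=\frac{2q(q-1)(2q)^{2k}}{(q-2)(2q-1)}-\frac{2q(8q)^k}{3(q-2)}+\frac{(4q-3)(2q)^k}{3(2q-1)},$$ $$\begin{aligned}\bar{\mathcal{K}}(H_{q,k})=\;&\frac{3q^3(q-1)(2q)^{2k}}{(q-2)(q+1)(2q-1)^2}-\frac{2q^2(8q)^k}{3(q-2)(2q-1)}+\frac{q(4q-3)(2q)^k}{3(2q-1)^2}\\&+\frac{2(3q^2+2q-2)4^k}{3(q+1)(2q-1)}+\frac{(q-1)(3q-2)}{3(2q-1)^2},\end{aligned}$$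 $$\begin{aligned}\mathcal{K}(H_{q,k})=\;&\frac{q^3(q-1)(2q)^{2k}}{2(q-2)(q+1)(2q-1)^2}-\frac{q^3(8q)^k}{6(q-2)(2q-1)^2}+\frac{q^2(4q-3)(2q)^k}{6(q+1)(2q-1)^2}+\frac{q(3q^2+2q-2)4^k}{3(q+1)(2q-1)^2}\\&+\frac{5q^4-9q^3-5q^2+12q-4}{2(q-2)(q+1)(2q-1)^2}\Big(\frac{2}{q}\Big)^k-\frac{(q-1)q(3q-2)}{6(q-2)(2q-1)^2}.\end{aligned}$$
   Context: The $q$-subdivision graph $S_q(G)$ of a simple connected graph $G$ is obtained from $G$ by replacing each edge $uv$ with $q$ disjoint paths of length $2$: $ux_1v,\ldots,ux_qv$. The hierarchical lattices are defined by: $H_{q,0}$ is a single edge connecting two nodes, and $H_{q,k}=S_q(H_{q,k-1})$ for $k\ge1$. For a connected graph $G$ with $m$ edges and node degrees $d_i$: Kemeny's constant is $K(G)=\sum_{j}\pi_jT_{ij}$ (independent of $i$), where $\pi_j=d_j/(2m)$ and $T_{ij}$ is the expected number of steps for the unbiased random walk (jumping to a uniformly random neighbor at each step) started at $i$ to first reach $j$, with $T_{ii}=0$. The resistance distance $r_{ij}$ is the effective resistance between $i$ and $j$ when each edge is replaced by a unit resistor. The Kirchhoff index is $\mathcal K(G)=\sum_{\{i,j\}\subseteq V(G)}r_{ij}$, the additive degree-Kirchhoff index is $\bar{\mathcal K}(G)=\sum_{\{i,j\}\subseteq V(G)}(d_i+d_j)r_{ij}$, and the multiplicative degree-Kirchhoff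 index is $\tilde{\mathcal K}(G)=\sum_{\{i,j\}\subseteq V(G)}d_id_jr_{ij}$, sums over unordered pairs of nodes.
   Formalization: The printed Kirchhoff index for q=2 is false for k≥2 (at k=2 it gives 649/9, the true value is 71); it is replaced by 2(3k+4)16^k/81 + 38·4^k/81 + (35−6k)/81, which agrees with the printed formula at k=0,1. *)

(* Defs.v *)
(* MathComp and MathComp-Analysis *)
From mathcomp Require Export all_boot all_order all_algebra.
From mathcomp Require Export boolp classical_sets reals constructive_ereal.
From mathcomp Require Export ereal topology normedtype sequences.

Set Implicit Arguments.
Unset Strict Implicit.
Unset Printing Implicit Defensive.

Import Order.TTheory GRing.Theory Num.Theory.
Local Open Scope ring_scope.

Record sgraph := SGraph {
  vertex :> finType;
  adj : rel vertex;
  adj_sym : symmetric adj;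
  adj_irrefl : irreflexive adj
}.

Definition is_edge (G : sgraph) : pred {set G} :=
  fun e => [exists x : G, exists y : G, adj x y && (e == [set x; y]%SET)].

Definition edge (G : sgraph) := {e : {set G} | is_edge e}.

Definition nb_edges (G : sgraph) : nat := #|{: edge G}|.

Definition degree (G : sgraph) (x : G) : nat := #|[pred y | adj x y]|.

(* Each edge e = {u, v} gives the q paths of length two u -- (e, a) -- v, where
   a : 'I_q; the edges of G themselves are removed. *)
Definition subdiv_adj (q : nat) (G : sgraph) : rel (G + edge G * 'I_q) :=
  fun s t => match s, t with
             | inl u, inr ea => u \in val ea.1
             | inr ea, inl u => u \in val ea.1
             | _, _ => false
             end.

Lemma subdiv_adj_sym (q : nat) (G : sgraph) : symmetric (@subdiv_adj q G).
Proof. by case=> [u|ea] [v|eb]. Qed.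

Lemma subdiv_adj_irrefl (q : nat) (G : sgraph) :
  irreflexive (@subdiv_adj q G).
Proof. by case. Qed.

Definition subdivision (q : nat) (G : sgraph) : sgraph :=
  SGraph (@subdiv_adj_sym q G) (@subdiv_adj_irrefl q G).

Definition single_edge_adj : rel bool := fun x y => x != y.

Lemma single_edge_sym : symmetric single_edge_adj.
Proof. by case; case. Qed.

Lemma single_edge_irrefl : irreflexive single_edge_adj.
Proof. by case. Qed.

Definition single_edge : sgraph := SGraph single_edge_sym single_edge_irrefl.

Definition hierarchical_lattice (q k : nat) : sgraph :=
  iter k (subdivision q) single_edge.

Definition transition (R : realType) (G : sgraph) (x y : G) : R :=
  (adj x y)%:R / (degree x)%:R.

(* Probability that the walk started at x visits the vertices of s in order
   during its first size s steps. *)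
Fixpoint trajectory_prob (R : realType) (G : sgraph) (x : G) (s : seq G) : R :=
  if s is y :: s' then transition R x y * trajectory_prob R y s' else 1.

(* P_i(tau_j = n), where tau_j = inf {n >= 0 | X_n = j}: the total probability
   of the trajectories X_0 = i, X_1, ..., X_n with X_n = j and X_m <> j for all
   m < n.  In particular tau_i = 0 for the walk started at i. *)
Definition hitting_prob (R : realType) (G : sgraph) (i j : G) (n : nat) : R :=
  \sum_(s : n.-tuple G | (last i s == j) && (j \notin belast i s))
    trajectory_prob R i s.

(* T_ij = E_i[tau_j], as an extended real.  The second summand accounts for the
   event tau_j = +oo; it vanishes when j is reached almost surely, because
   +oo * 0 = 0. *)
Definition hitting_time (R : realType) (G : sgraph) (i j : G) : \bar R :=
  (\sum_(0 <= n <oo) (n%:R * hitting_prob R i j n)%:E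
   + +oo * (1 - \sum_(0 <= n <oo) (hitting_prob R i j n)%:E))%E.

Definition stationary (R : realType) (G : sgraph) (j : G) : R :=
  (degree j)%:R / (2 * nb_edges G)%:R.

Definition kemeny_from (R : realType) (G : sgraph) (i : G) : \bar R :=
  (\sum_(j : G) (stationary R j)%:E * hitting_time R i j)%E.

(* Independence of the starting vertex i is part of the assertion. *)
Definition has_kemeny_constant (R : realType) (G : sgraph) (K : R) : Prop :=
  forall i : G, kemeny_from R i = K%:E.

(* Kirchhoff's current law, with Ohm's law for unit resistors: v is an electric
   potential on G when a unit current enters at i and leaves at j. *)
Definition unit_current_potential (R : realType) (G : sgraph) (i j : G)
    (v : G -> R) : Prop :=
  forall x : G, \sum_(y : G | adj x y) (v x - v y) = (x == i)%:R - (x == j)%:R.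

(* The potential drop v i - v j for a unit current from i to j; in a connected
   graph such a v exists and is unique up to an additive constant, so the set
   below is a singleton.  The default value 0 is used only when i and j lie in
   different components. *)
Definition resistance (R : realType) (G : sgraph) (i j : G) : R :=
  xget 0 [set r : R | exists2 v : G -> R,
    unit_current_potential i j v & r = v i - v j]%classic.

(* Sum over the unordered pairs {i, j} of distinct vertices, for a symmetric F:
   each pair is listed once, in the order of the enumeration of the vertices. *)
Definition pair_sum (R : realType) (G : sgraph) (F : G -> G -> R) : R :=
  \sum_(p : G * G | (enum_rank p.1 < enum_rank p.2)%N) F p.1 p.2.

Definition kirchhoff (R : realType) (G : sgraph) : R :=
  pair_sum (fun i j : G => resistance R i j).

Definition add_degree_kirchhoff (R : realType) (G : sgraph) : R :=
  pair_sum (fun i j : G => (degree i + degree j)%:R * resistance R i j).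

Definition mul_degree_kirchhoff (R : realType) (G : sgraph) : R :=
  pair_sum (fun i j : G => (degree i * degree j)%:R * resistance R i j).

(* Main.v *)
Require Import Defs.
From mathcomp Require Import all_boot all_order all_algebra.
From mathcomp Require Import reals.
From mathcomp Require Import ring lra.

Set Implicit Arguments.
Unset Strict Implicit.
Unset Printing Implicit Defensive.

Import Order.TTheory GRing.Theory Num.Theory numFieldNormedType.Exports.
Local Open Scope ring_scope.

(** Everything reduces to one linear-algebraic characterisation of the resistance
    distance.  A symmetric r with zero diagonal is the resistance distance as
    soon as, for each target y, the Laplacian of x |-> r x y equals tau x away
    from y and tau y - 2 at y, for some function tau independent of y
    ([resistance_kernel], [resistanceE]): then (r x j - r x i) / 2 is a potential
    for a unit current from i to j.  Summing over x gives sum tau = 2, hence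
    Foster's identity ([foster]).  The same equations show that
      h j x = 1/2 sum_k d_k (r x j + r j k - r x k)
    solves the first-step equations of the hitting time of j, so Kemeny's
    constant is the multiplicative index divided by the sum of the degrees
    ([kemeny_mul_degree_kirchhoff]).

    In the q-subdivision, give each vertex x a probability measure A_x on the old
    vertices: a point mass if x is old, the uniform measure on the two endpoints
    if x is new.  The new kernel is
      [x != y] (eps_x + eps_y)
        + (2/q) (r(A_x, A_y) - r(A_x, A_x)/2 - r(A_y, A_y)/2),
    where eps is 0 at old vertices and 1/2 at new ones.  Indeed q parallel paths
    of length two between old neighbours have resistance 2/q, and a new vertex is
    attached to the middle of its edge by two unit resistors in parallel.  That
    this is a resistance kernel is a direct computation of Laplacians
    ([subdivision_kernelP]).

    Summing this kernel against the weights 1 and d_x only involves the images of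
    the weights on the old vertices, which are 1 + (q/2) d and 2 q d, and the sum
    of the resistances of the edges, known by Foster's identity.  So the three
    Kirchhoff indices of S_q(G) are affine functions of those of G, with
    coefficients depending on q and on the numbers of vertices and edges
    ([kirchhoff_recurrences]), and the closed forms follow by induction on k. *)

(** * Sums over vertices, neighbours and edges *)

Definition laplacian (R : realType) (G : sgraph) (v : G -> R) (x : G) : R :=
  \sum_(y : G | adj x y) (v x - v y).

Lemma sum_delta (R : realType) (T : finType) (x : T) (f : T -> R) :
  \sum_y (y == x)%:R * f y = f x.
Proof.
rewrite (bigD1 x) //= eqxx mul1r big1 ?addr0 // => y /negbTE ->.
by rewrite mul0r.
Qed.

Lemma sum_adj_const (R : realType) (G : sgraph) (x : G) (c : R) :
  \sum_(y : G | adj x y) c = (degree x)%:R * c.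
Proof. by rewrite sumr_const mulr_natl. Qed.

Lemma degreeE (R : realType) (G : sgraph) (x : G) :
  (degree x)%:R = \sum_(y : G | adj x y) (1 : R).
Proof. by rewrite sum_adj_const mulr1. Qed.

(** The incident edges of u are in bijection with its neighbours.  Stating this
    for functions of the vertex set of the edge lets sums over edges be handled
    without ever choosing an orientation. *)
Lemma sum_incident_edges (R : realType) (G : sgraph) (u : G)
    (F : {set G} -> R) :
  \sum_(e : edge G | u \in val e) F (val e) =
  \sum_(w : G | adj u w) F [set u; w]%SET.
Proof.
pose S := [set [set u; w]%SET | w : G in adj u]%SET.
have -> : \sum_(w : G | adj u w) F [set u; w]%SET = \sum_(E in S) F E.
  rewrite big_imset //= => w1 w2 aw1 aw2 /setP E.
  have := E w1; rewrite !inE eqxx orbT => /esym /orP[/eqP w1u|/eqP //].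
  by move: aw1; rewrite w1u -topredE /= adj_irrefl.
transitivity (\sum_(E : {set G} | is_edge E && (u \in E)) F E).
  rewrite [RHS](reindex_omap (val : edge G -> {set G}) insub) /=; last first.
    by move=> E /andP[eE _]; rewrite insubT.
  by apply: eq_bigl => -[E eE] /=; rewrite insubT eE /= eqxx andbT.
apply: eq_bigl => E; apply/andP/imsetP => [[]|[w aw ->]].
  move=> /existsP[x /existsP[y /andP[axy /eqP ->]]]; rewrite !inE.
  case/orP=> /eqP ->; first by exists y.
  by exists x; [rewrite -topredE /= adj_sym | rewrite finset.setUC].
split; last by rewrite !inE eqxx.
by apply/existsP; exists u; apply/existsP; exists w; rewrite eqxx andbT.
Qed.

Lemma sum_incident_const (R : realType) (G : sgraph) (u : G) (c : R) :
  \sum_(e : edge G | u \in val e) c = (degree u)%:R * c.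
Proof. by rewrite (sum_incident_edges u (fun=> c)) sum_adj_const. Qed.

Lemma sum_pair (R : realType) (T : finType) (u w : T) (f : T -> R) :
  u != w -> \sum_(x in [set u; w]%SET) f x = f u + f w.
Proof. by move=> uw; rewrite big_setU1 ?inE //= big_set1. Qed.

Lemma adj_neq (G : sgraph) (u w : G) : adj u w -> u != w.
Proof. by apply: contraTneq => ->; rewrite adj_irrefl. Qed.

Lemma sum_edge1 (R : realType) (G : sgraph) (e : edge G) :
  \sum_(x in val e) 1 = 2 :> R.
Proof.
case: e => E /= /existsP[x /existsP[y /andP[/adj_neq xy /eqP ->]]].
by rewrite sum_pair.
Qed.

Lemma sum_edge_const (R : realType) (G : sgraph) (e : edge G) (c : R) :
  \sum_(x in val e) c = 2 * c.
Proof.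
by rewrite -(sum_edge1 R e) mulr_suml; apply: eq_bigr => x _; rewrite mul1r.
Qed.

Lemma sum_incident_adj (R : realType) (G : sgraph) (u : G) (p : G -> R) :
  \sum_(e : edge G | u \in val e) (2 * p u - \sum_(w in val e) p w) =
  laplacian p u.
Proof.
rewrite (sum_incident_edges u (fun E : {set G} => 2 * p u - \sum_(w in E) p w)).
by apply: eq_bigr => w /adj_neq uw; rewrite sum_pair //; ring.
Qed.

(** Double counting: u belongs to exactly d_u edges. *)
Lemma sum_edges (R : realType) (G : sgraph) (f : G -> R) :
  \sum_(e : edge G) \sum_(u in val e) f u = \sum_u (degree u)%:R * f u.
Proof.
rewrite (exchange_big_dep predT) //=; apply: eq_bigr => u _.
by rewrite (sum_incident_edges u (fun=> f u)) sum_adj_const.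
Qed.

Lemma handshake (R : realType) (G : sgraph) :
  \sum_(x : G) (degree x)%:R = 2 * (nb_edges G)%:R :> R.
Proof.
transitivity (\sum_(e : edge G) \sum_(u in val e) (1 : R)).
  by rewrite (sum_edges (fun=> 1)); apply: eq_bigr => x _; rewrite mulr1.
by under eq_bigr do rewrite sum_edge1; rewrite sumr_const mulr_natr.
Qed.

(** * Resistance kernels *)

Lemma laplacian_selfadjoint (R : realType) (G : sgraph) (v w : G -> R) :
  \sum_x laplacian v x * w x = \sum_x v x * laplacian w x.
Proof.
have expand (f g : G -> R) : \sum_x laplacian f x * g x =
  \sum_x (degree x)%:R * f x * g x - \sum_x \sum_(y | adj x y) f y * g x.
  rewrite -sumrB; apply: eq_bigr => x _.
  by rewrite /laplacian sumrB sum_adj_const mulrBl mulr_suml.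
under [RHS]eq_bigr do rewrite mulrC.
rewrite !expand; congr (_ - _).
  by apply: eq_bigr => x _; rewrite mulrAC.
rewrite (exchange_big_dep predT) //=; apply: eq_bigr => x _.
by apply: eq_big => [y|y _]; rewrite 1?adj_sym // mulrC.
Qed.

Lemma sum_laplacian (R : realType) (G : sgraph) (v : G -> R) :
  \sum_x laplacian v x = 0.
Proof.
have := laplacian_selfadjoint v (fun=> 1).
under eq_bigr do rewrite mulr1.
move=> ->; rewrite big1 // => x _.
by rewrite /laplacian big1 ?mulr0 // => y _; rewrite subrr.
Qed.

(** In matrix form, L r = tau 1^T - 2 I, with L the Laplacian. *)
Definition resistance_kernel (R : realType) (G : sgraph) (r : G -> G -> R) :=
  [/\ (forall x y, r x y = r y x), (forall x, r x x = 0) &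
      exists tau : G -> R, forall x y,
        laplacian (r^~ y) x = tau x - 2 * (x == y)%:R].

(** Pairing w with the Laplacian of v gives w i - w j, pairing v with that of w
    gives v i - v j, and the Laplacian is self-adjoint. *)
Lemma potential_drop_unique (R : realType) (G : sgraph) (i j : G)
    (v w : G -> R) :
  unit_current_potential i j v -> unit_current_potential i j w ->
  v i - v j = w i - w j.
Proof.
have drop (f g : G -> R) : unit_current_potential i j g ->
    \sum_x f x * laplacian g x = f i - f j.
  move=> gP; under eq_bigr do rewrite /laplacian gP mulrC mulrBl.
  by rewrite sumrB !sum_delta.
move=> vP wP; rewrite -(drop v w wP) -(drop w v vP) -laplacian_selfadjoint.
by apply: eq_bigr => x _; rewrite mulrC.
Qed.

Lemma resistanceE (R : realType) (G : sgraph) (r : G -> G -> R) :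
  resistance_kernel r -> forall i j, resistance R i j = r i j.
Proof.
move=> [rC r0 [tau tauP]] i j.
pose v x := (r x j - r x i) / 2.
have vP : unit_current_potential i j v.
  move=> x; transitivity ((laplacian (r^~ j) x - laplacian (r^~ i) x) / 2).
    rewrite /laplacian -sumrB mulr_suml; apply: eq_bigr => y _.
    by rewrite /v; ring.
  by rewrite !tauP; field.
have v_drop : v i - v j = r i j by rewrite /v !r0 (rC j i); field.
apply: xget_unique; first by exists v.
by move=> s [w wP ->]; rewrite -v_drop; apply: potential_drop_unique.
Qed.

(** Foster's identity, each edge being counted in both directions.  The defining
    equation at y = x says that the resistances at x add up to 2 - tau x, and the
    vanishing of the total Laplacian gives the sum of tau. *)
Lemma foster (R : realType) (G : sgraph) (r : G -> G -> R) :
  resistance_kernel r -> (0 < #|G|)%N ->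
  \sum_x \sum_(y : G | adj x y) r x y = 2 * (#|G|%:R - 1).
Proof.
move=> [rC r0 [tau tauP]] /card_gt0P [z _].
have tau_sum : \sum_x tau x = 2.
  have := sum_laplacian (r^~ z : G -> R).
  under eq_bigr do rewrite tauP mulrC.
  rewrite sumrB (sum_delta z (fun=> 2 : R)) => /eqP; rewrite subr_eq0 => /eqP.
  exact.
have star x : \sum_(y : G | adj x y) r x y = 2 - tau x.
  have -> : 2 - tau x = - laplacian (r^~ x) x by rewrite tauP eqxx mulr1; ring.
  rewrite /laplacian -sumrN; apply: eq_bigr => y _.
  by rewrite r0 (rC y x); ring.
under eq_bigr do rewrite star.
by rewrite sumrB tau_sum sumr_const -[2 *+ _]mulr_natr; ring.
Qed.

(** * Hitting times *)

(** One step of the walk from i, killed if it is already at j. *)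
Definition killed_step (R : realType) (G : sgraph) (j : G) (f : G -> R)
    (i : G) : R :=
  (i != j)%:R * \sum_y transition R i y * f y.

(** The probability that the walk has not visited j up to time n included. *)
Definition survival (R : realType) (G : sgraph) (j : G) (n : nat) : G -> R :=
  iter n (killed_step j) (fun i => (i != j)%:R).

Lemma transition_ge0 (R : realType) (G : sgraph) (i y : G) :
  0 <= transition R i y.
Proof. by rewrite /transition divr_ge0. Qed.

Lemma sum_transition (R : realType) (G : sgraph) (i : G) :
  (0 < degree i)%N -> \sum_y transition R i y = 1.
Proof.
move=> di; rewrite /transition -mulr_suml -natr_sum.
rewrite -big_mkcond /= sum1_card divff // pnatr_eq0 -lt0n //.
Qed.

Lemma hitting_prob0 (R : realType) (G : sgraph) (i j : G) :
  hitting_prob R i j 0 = (i == j)%:R.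
Proof.
rewrite /hitting_prob big_mkcond (bigD1 [tuple]) //= big1 ?addr0.
  by rewrite andbT; case: (i == j).
by move=> s /eqP []; apply: tuple0.
Qed.

Lemma hitting_probS (R : realType) (G : sgraph) (i j : G) (n : nat) :
  hitting_prob R i j n.+1 = killed_step j (fun y => hitting_prob R y j n) i.
Proof.
rewrite /hitting_prob /killed_step.
rewrite (reindex (fun p : G * n.-tuple G => [tuple of p.1 :: p.2])) /=;
    last first.
  exists (fun t => (thead t, [tuple of behead t])) => [[y s] _ | t _].
    by congr pair; apply: val_inj.
  by rewrite [RHS]tuple_eta.
transitivity (\sum_(p : G * n.-tuple G | (i != j) &&
    ((last p.1 p.2 == j) && (j \notin belast p.1 p.2)))
    transition R i p.1 * trajectory_prob R p.1 p.2).
  by apply: eq_bigl => -[y s] /=; rewrite inE negb_or [j == i]eq_sym andbCA.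
case: (i != j) => /=; last by rewrite big_pred0_eq mul0r.
rewrite mul1r; under [RHS]eq_bigr do rewrite mulr_sumr.
by rewrite pair_big_dep.
Qed.

Lemma killed_stepB (R : realType) (G : sgraph) (j : G) (f g : G -> R) (i : G) :
  killed_step j (fun x => f x - g x) i = killed_step j f i - killed_step j g i.
Proof.
rewrite /killed_step -mulrBr -sumrB; congr (_ * _).
by apply: eq_bigr => y _; rewrite mulrBr.
Qed.

Lemma killed_stepZ (R : realType) (G : sgraph) (j : G) (c : R) (f : G -> R)
    (i : G) :
  killed_step j (fun x => c * f x) i = c * killed_step j f i.
Proof.
rewrite /killed_step mulrCA; congr (_ * _); rewrite mulr_sumr.
by apply: eq_bigr => y _; rewrite mulrCA.
Qed.

Lemma killed_step_mono (R : realType) (G : sgraph) (j : G) (f g : G -> R) :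
  (forall x, f x <= g x) -> forall i, killed_step j f i <= killed_step j g i.
Proof.
move=> fg i; apply: ler_wpM2l => //; apply: ler_sum => y _.
by apply: ler_wpM2l; rewrite ?transition_ge0.
Qed.

Lemma killed_step_ge0 (R : realType) (G : sgraph) (j : G) (f : G -> R) :
  (forall x, 0 <= f x) -> forall i, 0 <= killed_step j f i.
Proof.
move=> f0 i; apply: mulr_ge0 => //; apply: sumr_ge0 => y _.
by rewrite mulr_ge0 ?transition_ge0.
Qed.

Lemma iter_killed_step_mono (R : realType) (G : sgraph) (j : G) (n : nat)
    (f g : G -> R) :
  (forall x, f x <= g x) ->
  forall i, iter n (killed_step j) f i <= iter n (killed_step j) g i.
Proof. by move=> fg; elim: n => //= n IH; apply: killed_step_mono. Qed.

Lemma survival_ge0 (R : realType) (G : sgraph) (j : G) (n : nat) (i : G) :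
  0 <= survival R j n i.
Proof. by elim: n i => [|n IH] i //=; apply: killed_step_ge0. Qed.

Lemma hitting_prob_survival (R : realType) (G : sgraph) (j : G) (n : nat)
    (i : G) : (forall x : G, (0 < degree x)%N) ->
  hitting_prob R i j n.+1 = survival R j n i - survival R j n.+1 i.
Proof.
move=> dpos; elim: n i => [|n IH] i; rewrite hitting_probS.
  rewrite -[survival R j 1 i]/(killed_step j (survival R j 0) i).
  rewrite /killed_step /survival /= -[X in _ = X - _]mulr1 -mulrBr.
  congr (_ * _).
  transitivity (\sum_y (transition R i y - transition R i y * (y != j)%:R)).
    apply: eq_bigr => y _; rewrite hitting_prob0.
    by case: (y == j); rewrite /= ?mulr0 ?mulr1 ?subr0 ?subrr.
  by rewrite sumrB sum_transition.
rewrite [survival R j n.+1]/survival [survival R j n.+2]/survival !iterS.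
rewrite -killed_stepB /killed_step; congr (_ * _).
by apply: eq_bigr => y _; rewrite IH.
Qed.

Lemma sum_hitting_prob (R : realType) (G : sgraph) (j : G) (n : nat)
    (i : G) : (forall x : G, (0 < degree x)%N) ->
  \sum_(0 <= m < n.+1) hitting_prob R i j m = 1 - survival R j n i.
Proof.
move=> dpos; elim: n => [|n IH].
  rewrite big_nat1 hitting_prob0 /survival /=.
  by case: (i == j); rewrite ?subr0 ?subrr.
by rewrite big_nat_recr // IH hitting_prob_survival //= addrA subrK.
Qed.

Section FirstStep.
Variables (R : realType) (G : sgraph) (j : G) (h : G -> R).
Hypothesis dpos : forall x : G, (0 < degree x)%N.
Hypothesis hj : h j = 0.
Hypothesis h_step : forall i, i != j -> h i = 1 + \sum_y transition R i y * h y.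

(** Minimum principle: at a minimum other than j, h would exceed its own minimum
    by at least 1. *)
Lemma first_step_ge0 i : 0 <= h i.
Proof.
have [i0 _ i0_min] : exists2 i0, True & forall x, h i0 <= h x.
  case: (arg_minP (P := predT) h (erefl (predT j))) => i0 _ i0_min.
  by exists i0 => // x; apply: i0_min.
have [i0j|i0j] := eqVneq i0 j; first by rewrite -hj -i0j.
suff : h i0 + 1 <= h i0 by rewrite gerDl ler10.
rewrite [leRHS](h_step i0j) addrC lerD2l.
rewrite -[leLHS]mul1r -(sum_transition R (dpos i0)) mulr_suml.
by apply: ler_sum => y _; apply: ler_wpM2l; rewrite ?transition_ge0.
Qed.

Lemma first_step_killed i : h i - killed_step j h i = (i != j)%:R.
Proof.
rewrite /killed_step; case: eqVneq => [->|ij] /=; first by rewrite hj; ring.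
by rewrite (h_step ij); ring.
Qed.

(** The sequence of killed iterates of h telescopes, because h minus its killed
    step is the survival probability at time 0. *)
Lemma survival_first_step n i :
  survival R j n i =
  iter n (killed_step j) h i - iter n.+1 (killed_step j) h i.
Proof.
elim: n i => [|n IH] i; first by rewrite /= first_step_killed.
rewrite /survival iterS -/(survival R j n) [in RHS]iterS.
rewrite [iter n.+2 _ _]iterS -killed_stepB /killed_step; congr (_ * _).
by apply: eq_bigr => y _; rewrite IH.
Qed.

(** Abel summation; the two correction terms will be shown to tend to 0. *)
Lemma sum_mul_hitting_prob n i :
  \sum_(0 <= m < n.+1) m%:R * hitting_prob R i j m =
  h i - n%:R * survival R j n i - iter n (killed_step j) h i.
Proof.
elim: n => [|n IH]; first by rewrite big_nat1 /=; ring.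
rewrite big_nat_recr // IH hitting_prob_survival //.
have -> : iter n.+1 (killed_step j) h i =
    iter n (killed_step j) h i - survival R j n i.
  by rewrite survival_first_step subKr.
set s := survival R j n i; set s1 := survival R j n.+1 i.
by rewrite -natr1 /=; ring.
Qed.

(** If C bounds h, then away from j one has 1 >= h / C, so a killed step subtracts
    at least h / C from h, which is a contraction by the factor 1 - 1/C. *)
Lemma killed_decay : exists C rho : R, [/\ 0 <= rho, rho < 1 &
  forall n i, iter n (killed_step j) h i <= C * rho ^+ n].
Proof.
(* The summand 1 makes C at least 1 and the ratio 1 - 1/C nonnegative. *)
pose C := 1 + \sum_x h x.
have hC x : h x <= C.
  rewrite /C (bigD1 x) //= addrCA lerDl addr_ge0 // sumr_ge0 // => y _.
  exact: first_step_ge0.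
have C1 : 1 <= C by rewrite lerDl sumr_ge0 // => y _; apply: first_step_ge0.
have C0 : 0 < C by apply: lt_le_trans C1.
exists C, (1 - C^-1); split.
- by rewrite subr_ge0 invf_le1.
- by rewrite gtrBl invr_gt0.
elim=> [|n IH] i; first by rewrite mulr1.
have contract x : killed_step j h x <= (1 - C^-1) * h x.
  rewrite mulrBl mul1r -[leLHS](subKr (h x)) first_step_killed lerD2l lerN2.
  rewrite ler_pdivrMl //; case: eqVneq => [->|_] /=; first by rewrite hj mulr0.
  by rewrite mulr1.
have rho0 : 0 <= 1 - C^-1 by rewrite subr_ge0 invf_le1.
have iterZ c m x : iter m (killed_step j) (fun x => c * h x) x =
    c * iter m (killed_step j) h x.
  elim: m x => //= m IHm x; rewrite -killed_stepZ /killed_step.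
  by congr (_ * _); apply: eq_bigr => y _; rewrite IHm.
rewrite iterSr (le_trans (iter_killed_step_mono j n contract i)) // iterZ.
by rewrite exprS mulrCA ler_wpM2l.
Qed.

End FirstStep.

(** With s the square root of rho, n s^n is at most the sum of the s^i for i < n,
    hence bounded, and the other factor s^n tends to 0. *)
Lemma cvg_arith_geometric (R : realType) (rho : R) : 0 <= rho -> rho < 1 ->
  ((fun n : nat => n%:R * rho ^+ n) @ \oo --> 0)%classic.
Proof.
move=> rho0 rho1; pose s := Num.sqrt rho.
have s0 : 0 <= s := sqrtr_ge0 _.
have s1 : s < 1 by rewrite -sqrtr1 ltr_sqrt.
have sE : rho = s ^+ 2 by rewrite sqr_sqrtr.
have bound n : n%:R * s ^+ n <= (1 - s)^-1.
  have : n%:R * s ^+ n <= \sum_(i < n) s ^+ i.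
    rewrite mulr_natl -[in leLHS](card_ord n) -sumr_const.
    apply: ler_sum => i _.
    by apply: ler_wiXn2l => //; [exact: ltW | rewrite card_ord ltnW].
  move=> /le_trans; apply.
  rewrite -[leRHS]mul1r ler_pdivlMr ?subr_gt0 // mulrC -opprB mulNr -subrX1.
  by rewrite opprB gerBl exprn_ge0.
apply: (@squeeze_cvgr _ _ _ _ (fun=> 0) (geometric (1 - s)^-1 s)).
- near=> n; rewrite mulr_ge0 ?exprn_ge0 //= sE -exprM.
  rewrite mul2n -addnn exprD mulrA ler_wpM2r ?exprn_ge0 //.
- exact: cvg_cst.
- by apply: cvg_geometric; rewrite ger0_norm.
Unshelve. all: by end_near.
Qed.

Lemma nneseries_lim (R : realType) (u : nat -> R) (l : R) :
  ((fun n => \sum_(0 <= m < n.+1) u m) @ \oo --> l)%classic ->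
  (\sum_(0 <= n <oo) (u n)%:E = l%:E)%E.
Proof.
move=> ul; apply/cvg_lim => //; rewrite -cvg_shiftS.
rewrite (_ : (fun n => _) = EFin \o (fun n => \sum_(0 <= m < n.+1) u m)).
  by apply: cvg_comp ul _; apply: cvg_id.
by apply/funext => n /=; rewrite sumEFin.
Qed.

(** A finite solution of the first-step equations is the hitting time: the
    geometric decay of the killed iterates makes the walk reach j almost surely
    and makes the boundary terms of the Abel summation vanish. *)
Lemma hitting_time_first_step (R : realType) (G : sgraph) (j : G) (h : G -> R) :
  (forall x : G, (0 < degree x)%N) -> h j = 0 ->
  (forall i, i != j -> h i = 1 + \sum_y transition R i y * h y) ->
  forall i, hitting_time R i j = (h i)%:E.
Proof.
move=> dpos hj h_step i.
have [C [rho [rho0 rho1 decay]]] := killed_decay dpos hj h_step.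
have e_ge0 n x : 0 <= iter n (killed_step j) h x.
  elim: n x => [|n IH] x; first exact: (first_step_ge0 dpos hj h_step).
  exact: killed_step_ge0.
have s_le n : survival R j n i <= C * rho ^+ n.
  rewrite (survival_first_step hj h_step) (le_trans _ (decay n i)) //.
  by rewrite gerBl e_ge0.
have geo0 : ((fun n : nat => C * rho ^+ n) @ \oo --> (0 : R))%classic.
  by apply: cvg_geometric; rewrite ger0_norm.
have s_cvg : ((fun n => survival R j n i) @ \oo --> (0 : R))%classic.
  apply: (squeeze_cvgr _ (cvg_cst 0) geo0).
  by near=> n; rewrite survival_ge0 s_le.
have e_cvg : ((fun n => iter n (killed_step j) h i) @ \oo --> (0 : R))%classic.
  apply: (squeeze_cvgr _ (cvg_cst 0) geo0).
  by near=> n; rewrite e_ge0 decay.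
have ns_cvg :
    ((fun n => n%:R * survival R j n i) @ \oo --> (0 : R))%classic.
  have lim0 :
      ((fun n : nat => C * (n%:R * rho ^+ n)) @ \oo --> (0 : R))%classic.
    by rewrite -(mulr0 C); apply: cvgMr; apply: cvg_arith_geometric.
  apply: (squeeze_cvgr _ (cvg_cst 0) lim0).
  near=> n; rewrite mulr_ge0 ?survival_ge0 //= mulrCA.
  by rewrite ler_wpM2l.
rewrite /hitting_time.
rewrite (@nneseries_lim _ (fun n => n%:R * hitting_prob R i j n) (h i)).
  rewrite (@nneseries_lim _ (hitting_prob R i j) 1).
    by rewrite subee // mule0 adde0.
  under eq_fun do rewrite sum_hitting_prob //.
  have := cvgB (cvg_cst (1 : R)) s_cvg; rewrite subr0; exact.
under eq_fun do rewrite (sum_mul_hitting_prob dpos hj h_step).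
have := cvgB (cvgB (cvg_cst (h i)) ns_cvg) e_cvg; rewrite !subr0; exact.
Unshelve. all: by end_near.
Qed.

(** * Degree-Kirchhoff indices and Kemeny's constant *)

(** The sum over ordered pairs, obtained by gathering (x, y) with (y, x). *)
Lemma pair_sumE (R : realType) (G : sgraph) (F : G -> G -> R) :
  (forall x, F x x = 0) ->
  pair_sum (fun x y => F x y + F y x) = \sum_x \sum_y F x y.
Proof.
move=> F0; rewrite pair_big /=.
rewrite (bigID (fun p : G * G => (enum_rank p.1 < enum_rank p.2)%N)) /=.
rewrite /pair_sum big_split /=; congr (_ + _).
rewrite [RHS](bigID (fun p : G * G => p.1 == p.2)) /=.
rewrite [X in _ = X + _]big1 ?add0r; last by move=> [x y] /= /andP[_ /eqP ->].
rewrite (reindex_inj (h := fun p : G * G => (p.2, p.1))) /=; last first.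
  by move=> [a b] [c d] /= [-> ->].
apply: eq_bigl => -[x y] /=.
have rank_eq : (enum_rank y == enum_rank x :> nat) = (x == y).
  by rewrite eq_sym -(inj_eq enum_rank_inj) -val_eqE.
rewrite -leqNgt [in RHS]leq_eqVlt rank_eq.
by case: eqVneq => [->|] /=; rewrite ?ltnn // andbT.
Qed.

Lemma mul_degree_kirchhoffE (R : realType) (G : sgraph) (r : G -> G -> R) :
  resistance_kernel r ->
  2 * mul_degree_kirchhoff R G =
  \sum_x \sum_y (degree x)%:R * (degree y)%:R * r x y.
Proof.
move=> rP; have [rC r0 _] := rP.
rewrite -pair_sumE; last by move=> x; rewrite r0 mulr0.
rewrite /mul_degree_kirchhoff /pair_sum mulr_sumr.
apply: eq_bigr => -[x y] _ /=.
by rewrite (resistanceE rP) (rC y x) natrM; ring.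
Qed.

Lemma add_degree_kirchhoffE (R : realType) (G : sgraph) (r : G -> G -> R) :
  resistance_kernel r ->
  add_degree_kirchhoff R G = \sum_x \sum_y (degree x)%:R * r x y.
Proof.
move=> rP; have [rC r0 _] := rP.
rewrite -pair_sumE; last by move=> x; rewrite r0 mulr0.
apply: eq_bigr => -[x y] _ /=.
by rewrite (resistanceE rP) (rC y x) natrD mulrDl.
Qed.

Lemma kirchhoffE (R : realType) (G : sgraph) (r : G -> G -> R) :
  resistance_kernel r -> 2 * kirchhoff R G = \sum_x \sum_y r x y.
Proof.
move=> rP; have [rC r0 _] := rP.
rewrite -pair_sumE //.
rewrite /kirchhoff /pair_sum mulr_sumr; apply: eq_bigr => -[x y] _ /=.
by rewrite (resistanceE rP) (rC y x); ring.
Qed.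

(** When the formula for the hitting times is averaged over j against the degrees,
    the two terms involving the starting point i cancel, which leaves the
    multiplicative index. *)
Lemma kemeny_mul_degree_kirchhoff (R : realType) (G : sgraph)
    (r : G -> G -> R) :
  resistance_kernel r -> (forall x : G, (0 < degree x)%N) ->
  has_kemeny_constant G (mul_degree_kirchhoff R G / (2 * (nb_edges G)%:R)).
Proof.
move=> rP dpos i; have [rC r0 [tau tauP]] := rP.
pose h j x := (\sum_k (degree k)%:R * (r x j + r j k - r x k)) / 2.
have hT j : hitting_time R i j = (h j i)%:E.
  apply: hitting_time_first_step => // [|x xj].
    rewrite /h big1 ?mul0r // => k _; rewrite r0; ring.
  have dx : (degree x)%:R != 0 :> R by rewrite pnatr_eq0 -lt0n.
  have Lh : laplacian (h j) x = (degree x)%:R.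
    transitivity ((\sum_k (degree k)%:R *
        (laplacian (r^~ j) x - laplacian (r^~ k) x)) / 2).
      rewrite /laplacian.
      under [in RHS]eq_bigr => k _ do rewrite -sumrB mulr_sumr.
      rewrite exchange_big /= mulr_suml; apply: eq_bigr => y _.
      rewrite /h -mulrBl -sumrB; congr (_ / _).
      by apply: eq_bigr => k _; ring.
    transitivity (\sum_k (k == x)%:R * (degree k)%:R : R).
      rewrite mulr_suml; apply: eq_bigr => k _.
      by rewrite !tauP (negbTE xj) eq_sym /=; field.
    exact: sum_delta.
  move: Lh; rewrite /laplacian sumrB sum_adj_const => Lh.
  apply: (mulfI dx); rewrite mulrDr mulr1 mulr_sumr.
  have -> : \sum_y (degree x)%:R * (transition R x y * h j y) =
      \sum_(y | adj x y) h j y.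
    rewrite [RHS]big_mkcond; apply: eq_bigr => y _; rewrite /transition.
    by case: (adj x y) => /=; field.
  by apply/eqP; rewrite -subr_eq Lh.
rewrite /kemeny_from; under eq_bigr do rewrite hT -EFinM.
rewrite sumEFin; congr EFin.
set M := mul_degree_kirchhoff R G; set m := (nb_edges G)%:R.
have -> : M / (2 * m) = (2 * M) / (4 * m).
  by rewrite !invfM; set mi := m^-1; field.
rewrite /M (mul_degree_kirchhoffE rP).
transitivity ((\sum_j \sum_k ((degree j)%:R * (degree k)%:R * r j k
   + ((degree j)%:R * (degree k)%:R * r i j
      - (degree j)%:R * (degree k)%:R * r i k))) / (4 * m)).
  rewrite mulr_suml; apply: eq_bigr => j _.
  transitivity ((degree j)%:R * (\sum_k (degree k)%:R * (r i j + r j k - r i k))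
      / (4 * m)).
    rewrite /stationary /h natrM -/m !invfM; set mi := m^-1.
    by set S := \sum_k _; field.
  by congr (_ / _); rewrite mulr_sumr; apply: eq_bigr => k _; ring.
congr (_ / _).
under eq_bigr do rewrite big_split sumrB /=.
rewrite big_split sumrB /= [X in _ + (_ - X)]exchange_big /=.
rewrite [X in _ + X](_ : _ = 0) ?addr0 //.
apply/eqP; rewrite subr_eq0; apply/eqP.
by apply: eq_bigr => j _; apply: eq_bigr => k _; rewrite [X in X * _]mulrC.
Qed.

(** * The resistance kernel of a subdivision *)

(** The potential and the mutual energy of charge distributions for the kernel
    r; [energy r a b] is the bilinear form of r. *)
Definition potential (R : realType) (G : sgraph) (r : G -> G -> R)
    (b : G -> R) (u : G) : R :=
  \sum_w b w * r u w.

Definition energy (R : realType) (G : sgraph) (r : G -> G -> R)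
    (a b : G -> R) : R :=
  \sum_u a u * potential r b u.

Lemma energyC (R : realType) (G : sgraph) (r : G -> G -> R) (a b : G -> R) :
  (forall x y, r x y = r y x) -> energy r a b = energy r b a.
Proof.
move=> rC; rewrite /energy /potential.
under eq_bigr do rewrite mulr_sumr.
under [RHS]eq_bigr do rewrite mulr_sumr.
rewrite exchange_big; apply: eq_bigr => u _; apply: eq_bigr => w _ /=.
by rewrite (rC w u) mulrCA.
Qed.

Lemma laplacian_potential (R : realType) (G : sgraph) (r : G -> G -> R)
    (tau b : G -> R) (x : G) :
  (forall x y, laplacian (r^~ y) x = tau x - 2 * (x == y)%:R) ->
  laplacian (potential r b) x = (\sum_w b w) * tau x - 2 * b x.
Proof.
move=> tauP; transitivity (\sum_w b w * laplacian (r^~ w) x).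
  rewrite /laplacian; under [RHS]eq_bigr do rewrite mulr_sumr.
  rewrite exchange_big; apply: eq_bigr => y _ /=.
  by rewrite /potential -sumrB; apply: eq_bigr => w _; rewrite mulrBr.
transitivity (\sum_w (b w * tau x - (w == x)%:R * (2 * b w))).
  by apply: eq_bigr => w _; rewrite tauP [w == x]eq_sym; ring.
by rewrite sumrB -mulr_suml (sum_delta x (fun w => 2 * b w)).
Qed.

Section Subdivision.
Variables (R : realType) (q : nat) (G : sgraph).
Local Notation H := (subdivision q G).
Local Notation Q := (q%:R : R).
Local Notation old u := (inl u : H).
Local Notation new e a := (inr (e, a) : H).

Lemma sum_subdivision (phi : H -> R) :
  \sum_(x : H) phi x =
  \sum_u phi (old u) + \sum_(e : edge G) \sum_(a < q) phi (new e a).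
Proof.
rewrite big_sumType /=; congr (_ + _).
by rewrite pair_bigA; apply: eq_bigr => -[].
Qed.

Lemma sum_adj_old (u : G) (phi : H -> R) :
  \sum_(y : H | adj (old u) y) phi y =
  \sum_(e : edge G | u \in val e) \sum_(a < q) phi (new e a).
Proof.
rewrite big_sumType /= big_pred0_eq add0r.
rewrite (pair_big (fun e : edge G => u \in val e) predT
  (fun e a => phi (new e a))) /=.
by apply: eq_big => [[e a]|[e a] _] //=; rewrite andbT.
Qed.

Lemma sum_adj_new (e : edge G) (a : 'I_q) (phi : H -> R) :
  \sum_(y : H | adj (new e a) y) phi y = \sum_(u in val e) phi (old u).
Proof. by rewrite big_sumType /= big_pred0_eq addr0. Qed.

Lemma degree_old (u : G) : (degree (old u))%:R = Q * (degree u)%:R.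
Proof.
rewrite degreeE sum_adj_old.
under eq_bigr do rewrite sumr_const card_ord.
by rewrite sum_incident_const mulrC.
Qed.

Lemma degree_new (e : edge G) (a : 'I_q) : (degree (new e a))%:R = 2 :> R.
Proof. by rewrite degreeE sum_adj_new sum_edge1. Qed.

Lemma card_subdivision : #|{: H}|%:R = #|G|%:R + Q * (nb_edges G)%:R :> R.
Proof.
by rewrite card_sum card_prod card_ord natrD natrM mulrC.
Qed.

Lemma nb_edges_subdivision : (nb_edges H)%:R = 2 * Q * (nb_edges G)%:R :> R.
Proof.
have two : (2 : R) != 0 by rewrite pnatr_eq0.
apply: (mulfI two); rewrite -handshake sum_subdivision.
under eq_bigr do rewrite degree_old.
rewrite -mulr_sumr handshake.
under eq_bigr do under eq_bigr do rewrite degree_new.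
under eq_bigr do rewrite sumr_const card_ord.
rewrite sumr_const -/(nb_edges G) -[2 *+ q]mulr_natr.
by rewrite -[_ *+ nb_edges G]mulr_natr; ring.
Qed.

(** The probability measure on the old vertices that represents x: by symmetry a
    new vertex sees the old network through the midpoint of its edge. *)
Definition shadow (x : G + edge G * 'I_q) (u : G) : R :=
  match x with
  | inl v => (u == v)%:R
  | inr ea => (u \in val ea.1)%:R / 2
  end.

(** The resistance between x and the midpoint that represents it, namely two
    unit resistors in parallel when x is a new vertex. *)
Definition half_path (x : G + edge G * 'I_q) : R :=
  if x is inr _ then 1 / 2 else 0.

Lemma sum_shadow_old (v : G) (f : G -> R) : \sum_u shadow (old v) u * f u = f v.
Proof. exact: sum_delta. Qed.

Lemma sum_shadow_new (e : edge G) (a : 'I_q) (f : G -> R) :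
  \sum_u shadow (new e a) u * f u = (\sum_(u in val e) f u) / 2.
Proof.
rewrite mulr_suml [RHS]big_mkcond; apply: eq_bigr => u _ /=.
by case: (u \in val e); rewrite /= ?mul0r // mulrC mul1r.
Qed.

Lemma sum_shadow (x : H) : \sum_u shadow x u = 1.
Proof.
under eq_bigr do rewrite -[shadow _ _]mulr1.
case: x => [v|[e a]]; first by rewrite (sum_shadow_old v (fun=> 1)).
by rewrite (sum_shadow_new e a (fun=> 1)) sum_edge1 divff // pnatr_eq0.
Qed.

Variable r : G -> G -> R.
Hypothesis rP : resistance_kernel r.

Local Notation self_energy x := (energy r (shadow x) (shadow x)).

Definition subdivision_kernel (x y : G + edge G * 'I_q) : R :=
  (x != y)%:R * (half_path x + half_path y) +
  2 / Q * (energy r (shadow x) (shadow y)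
           - self_energy x / 2 - self_energy y / 2).

Lemma self_energy_old (u : G) : self_energy (old u) = 0.
Proof.
have [_ r0 _] := rP.
by rewrite /energy sum_shadow_old /potential sum_shadow_old.
Qed.

Lemma self_energy_new (e : edge G) (a : 'I_q) :
  self_energy (new e a) = (\sum_(u in val e) \sum_(w in val e) r u w) / 4.
Proof.
rewrite /energy sum_shadow_new.
under eq_bigr do rewrite /potential sum_shadow_new.
by rewrite -mulr_suml; field.
Qed.

(** The energy of the uniform measure on the endpoints, that is half the
    resistance of the edge. *)
Definition edge_energy (e : edge G) : R :=
  (\sum_(u in val e) \sum_(w in val e) r u w) / 4.

Lemma kernel_old (u : G) (y : H) :
  subdivision_kernel (old u) y =
  half_path y + 2 / Q * (potential r (shadow y) u - self_energy y / 2).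
Proof.
rewrite /subdivision_kernel self_energy_old /energy sum_shadow_old mul0r subr0.
congr (_ + _); case: y => [v|ea]; first by rewrite /= addr0 mulr0.
by rewrite mul1r /= add0r.
Qed.

Lemma kernel_new (e : edge G) (a : 'I_q) (y : H) :
  subdivision_kernel (new e a) y =
  (new e a != y)%:R * (1 / 2 + half_path y) +
  2 / Q * ((\sum_(u in val e) potential r (shadow y) u) / 2
           - edge_energy e / 2 - self_energy y / 2).
Proof.
by rewrite /subdivision_kernel self_energy_new {1}/energy sum_shadow_new.
Qed.

(** At a new vertex the neighbours average to its own measure, so the terms in
    the measure of the target cancel.  At an old vertex u the differences of
    potentials add up to the Laplacian on G, which contributes -2 times the mass
    at u of the measure of y: this is the required term if y is old, and is
    compensated by the missing diagonal term if y is a new neighbour of u. *)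
Lemma subdivision_kernelP : (0 < q)%N ->
  resistance_kernel (subdivision_kernel : H -> H -> R).
Proof.
move=> q0; have [rC r0 [tau tauP]] := rP.
have Q0 : Q != 0 by rewrite pnatr_eq0 -lt0n.
split.
- move=> x y; rewrite /subdivision_kernel eq_sym (energyC _ _ rC).
  by rewrite [half_path x + _]addrC addrAC.
- by move=> x; rewrite /subdivision_kernel eqxx mul0r; field.
(* As in the proof of Foster's identity, tau x has to be 2 minus the sum of the
   resistances of the edges at x. *)
exists (fun x => match x with
  | inl u => tau u - Q * (degree u)%:R / 2
             + \sum_(e : edge G | u \in val e) edge_energy e
  | inr ea => 1 - 2 / Q * edge_energy ea.1
  end) => -[u|[e a]] y; rewrite /laplacian.
- rewrite sum_adj_old.
  set p := potential r (shadow y).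
  transitivity (\sum_(e : edge G | u \in val e)
      (- (Q / 2) + (2 * p u - \sum_(w in val e) p w) + edge_energy e
       + \sum_(a < q) (new e a == y)%:R)).
    apply: eq_bigr => e _.
    transitivity (\sum_(a < q) (2 / Q * (- (Q / 4) +
      (2 * p u - \sum_(w in val e) p w) / 2 + edge_energy e / 2)
      + (new e a == y)%:R)).
      apply: eq_bigr => a _; rewrite kernel_old kernel_new -/p.
      case: (eqVneq (new e a) y) => [<-|_] /=; by field.
    rewrite big_split /= sumr_const card_ord -mulr_natr; congr (_ + _).
    by field.
  rewrite 3!big_split /= sum_incident_adj /p (laplacian_potential _ _ tauP).
  rewrite sum_shadow sum_incident_const.
  have -> : \sum_(e : edge G | u \in val e) \sum_(a < q) (new e a == y)%:R =
      2 * shadow y u - 2 * (old u == y)%:R.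
    case: y @p => [v|[f b]] p.
      rewrite big1 ?subrr // => e _; apply: big1 => a _ //.
    rewrite mulr0 subr0 (pair_big (fun e : edge G => u \in val e) predT
      (fun e a => (new e a == new f b)%:R : R)) /= mulrCA divff ?pnatr_eq0 //.
    rewrite mulr1 big_mkcond (bigD1 (f, b)) //= andbT eqxx.
    rewrite big1 ?addr0; first by case: (u \in val f).
    move=> [e a] ne; case: ifP => // _.
    by rewrite (_ : (_ == _) = false) //; apply: negbTE.
  by field.
rewrite sum_adj_new.
transitivity (2 * subdivision_kernel (new e a) y
   - \sum_(u in val e) subdivision_kernel (old u) y).
  by rewrite sumrB sum_edge_const.
set S := \sum_(u in _) _.
have -> : S = 2 / Q * (\sum_(u in val e) potential r (shadow y) u)
     + 2 * (half_path y - 2 / Q * (self_energy y / 2)).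
  rewrite /S; under eq_bigr do rewrite kernel_old.
  by rewrite big_split -mulr_sumr sumrB /= !sum_edge_const; ring.
rewrite kernel_new.
by case: (eqVneq (new e a) y) => [<-|_] /=; field.
Qed.

(** The image on the old vertices of a weight on the subdivision. *)
Definition push (alpha : H -> R) (u : G) : R :=
  \sum_(x : H) alpha x * shadow x u.

Lemma sum_energy_shadow (alpha beta : H -> R) :
  \sum_(x : H) \sum_(y : H) alpha x * beta y * energy r (shadow x) (shadow y) =
  energy r (push alpha) (push beta).
Proof.
have pushE (ga : H -> R) (f : G -> R) :
    \sum_u push ga u * f u = \sum_(x : H) ga x * \sum_u shadow x u * f u.
  under [RHS]eq_bigr do rewrite mulr_sumr.
  rewrite exchange_big; apply: eq_bigr => u _; rewrite mulr_suml.
  by apply: eq_bigr => x _; rewrite mulrA.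
rewrite [RHS]/energy pushE; apply: eq_bigr => x _.
under eq_bigr do rewrite -mulrA.
rewrite -mulr_sumr; congr (_ * _).
under [RHS]eq_bigr do rewrite /potential pushE mulr_sumr.
rewrite exchange_big; apply: eq_bigr => y _ /=.
rewrite mulr_sumr; apply: eq_bigr => u _.
by rewrite mulrCA.
Qed.

(** All three indices of the subdivision are instances, with alpha and beta equal
    to the degree or to 1. *)
Lemma weighted_kernel_sum (alpha beta : H -> R) :
  \sum_(x : H) \sum_(y : H) alpha x * beta y * subdivision_kernel x y =
  (\sum_(y : H) beta y) * (\sum_(x : H) alpha x * half_path x)
  + (\sum_(x : H) alpha x) * (\sum_(y : H) beta y * half_path y)
  - 2 * (\sum_(x : H) alpha x * beta x * half_path x)
  + 2 / Q * (energy r (push alpha) (push beta)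
    - (\sum_(y : H) beta y) * (\sum_(x : H) alpha x * self_energy x) / 2
    - (\sum_(x : H) alpha x) * (\sum_(y : H) beta y * self_energy y) / 2).
Proof.
have sum_prod (f g : H -> R) :
    \sum_(x : H) \sum_(y : H) f x * g y = (\sum_(x : H) f x) * \sum_(y : H) g y.
  by rewrite mulr_suml; apply: eq_bigr => x _; rewrite mulr_sumr.
rewrite -sum_energy_shadow.
have -> : (\sum_(y : H) beta y) * (\sum_(x : H) alpha x * half_path x) =
    \sum_(x : H) \sum_(y : H) alpha x * half_path x * beta y.
  by rewrite mulrC sum_prod.
have -> : (\sum_(x : H) alpha x) * (\sum_(y : H) beta y * half_path y) =
    \sum_(x : H) \sum_(y : H) alpha x * (beta y * half_path y).
  by rewrite sum_prod.
have -> : 2 * (\sum_(x : H) alpha x * beta x * half_path x) =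
   \sum_(x : H) \sum_(y : H)
     (y == x)%:R * (alpha x * beta y * (half_path x + half_path y)).
  rewrite mulr_sumr; apply: eq_bigr => x _.
  rewrite (sum_delta x
    (fun y => alpha x * beta y * (half_path x + half_path y))).
  by ring.
have -> : (\sum_(y : H) beta y) * (\sum_(x : H) alpha x * self_energy x) / 2 =
    \sum_(x : H) \sum_(y : H) alpha x * self_energy x * (beta y / 2).
  by rewrite sum_prod -mulr_suml; ring.
have -> : (\sum_(x : H) alpha x) * (\sum_(y : H) beta y * self_energy y) / 2 =
    \sum_(x : H) \sum_(y : H) alpha x / 2 * (beta y * self_energy y).
  by rewrite sum_prod -mulr_suml; ring.
rewrite !pair_bigA /= -!sumrB mulr_sumr -big_split -sumrB -big_split /=.
apply: eq_bigr => -[x y] _ /=.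
by rewrite /subdivision_kernel [y == x]eq_sym; case: (x == y) => /=; ring.
Qed.

End Subdivision.

(** * Kirchhoff indices of a subdivision *)

Lemma energyE (R : realType) (G : sgraph) (r : G -> G -> R) (a b : G -> R) :
  energy r a b = \sum_x \sum_y a x * b y * r x y.
Proof.
rewrite /energy /potential; apply: eq_bigr => x _; rewrite mulr_sumr.
by apply: eq_bigr => y _; rewrite mulrA.
Qed.

Section Indices.
Variables (R : realType) (q : nat) (G : sgraph) (r : G -> G -> R).
Hypothesis q0 : (0 < q)%N.
Hypothesis rP : resistance_kernel r.
Hypothesis G0 : (0 < #|G|)%N.
Local Notation H := (subdivision q G).
Local Notation Q := (q%:R : R).
Local Notation n := (#|G|%:R : R).
Local Notation m := ((nb_edges G)%:R : R).
Local Notation deg := (fun x : H => (degree x)%:R : R).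
Local Notation one := (fun x : H => 1 : R).
Local Notation self_energy x := (energy r (shadow R x) (shadow R x)).

Let Q0 : Q != 0. Proof. by rewrite pnatr_eq0 -lt0n. Qed.

(** Foster's identity in terms of edge energies. *)
Lemma sum_edge_energy : \sum_(e : edge G) edge_energy r e = (n - 1) / 2.
Proof.
have [rC r0 _] := rP.
rewrite /edge_energy -mulr_suml (exchange_big_dep predT) //=.
under eq_bigr => u _ do
  rewrite (sum_incident_edges u (fun E : {set G} => \sum_(w in E) r u w)).
transitivity ((\sum_u \sum_(w : G | adj u w) r u w) / 4).
  congr (_ / _); apply: eq_bigr => u _; apply: eq_bigr => w /adj_neq uw.
  by rewrite sum_pair // r0 add0r.
by rewrite (foster rP G0); field.
Qed.

Lemma sum_new_const (f : edge G -> R) :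
  \sum_(e : edge G) \sum_(a < q) f e = Q * \sum_(e : edge G) f e.
Proof.
rewrite mulr_sumr; apply: eq_bigr => e _.
by rewrite sumr_const card_ord mulr_natl.
Qed.

Lemma sum_edge_one (c : R) : \sum_(e : edge G) c = m * c.
Proof. by rewrite sumr_const mulr_natl. Qed.

Lemma total_deg : \sum_(x : H) deg x = 4 * Q * m.
Proof. by rewrite handshake nb_edges_subdivision; ring. Qed.

Lemma total_one : \sum_(x : H) one x = n + Q * m.
Proof. by rewrite sumr_const card_subdivision. Qed.

Lemma half_path_sum (alpha : H -> R) (c : R) :
  (forall e a, alpha (inr (e, a)) = c) ->
  \sum_(x : H) alpha x * half_path R x = Q * m * c / 2.
Proof.
move=> alphaE; rewrite sum_subdivision big1 ?add0r; last first.
  by move=> u _; rewrite mulr0.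
under eq_bigr do under eq_bigr do rewrite alphaE /=.
by rewrite sum_new_const sum_edge_one; field.
Qed.

Lemma self_energy_sum (alpha : H -> R) (c : R) :
  (forall e a, alpha (inr (e, a)) = c) ->
  \sum_(x : H) alpha x * self_energy x = Q * c * (n - 1) / 2.
Proof.
move=> alphaE; rewrite sum_subdivision big1 ?add0r; last first.
  by move=> u _; rewrite (self_energy_old q rP) mulr0.
under eq_bigr do under eq_bigr do rewrite alphaE self_energy_new.
rewrite sum_new_const -mulr_sumr (_ : \sum_e _ = \sum_e edge_energy r e) //.
by rewrite sum_edge_energy; ring.
Qed.

Lemma push_sum (alpha : H -> R) (c : R) (u : G) :
  (forall e a, alpha (inr (e, a)) = c) ->
  push alpha u = alpha (inl u) + Q * c / 2 * (degree u)%:R.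
Proof.
move=> alphaE; rewrite /push sum_subdivision; congr (_ + _).
  rewrite -[RHS](sum_delta u (fun v => alpha (inl v))).
  by apply: eq_bigr => v _; rewrite mulrC /= eq_sym.
under eq_bigr do under eq_bigr do rewrite alphaE /=.
rewrite sum_new_const.
transitivity (Q * \sum_(e : edge G | u \in val e) c / 2).
  congr (_ * _); rewrite [RHS]big_mkcond; apply: eq_bigr => e _.
  by case: (u \in val e) => /=; field.
by rewrite (sum_incident_const u); field.
Qed.

Lemma push_deg (u : G) : push deg u = 2 * Q * (degree u)%:R.
Proof.
rewrite (@push_sum deg 2) ?degree_old; first by field.
by move=> e a; rewrite degree_new.
Qed.

Lemma push_one (u : G) : push one u = 1 + Q / 2 * (degree u)%:R.
Proof. by rewrite (@push_sum one 1) // mulr1. Qed.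

Lemma energy_deg_deg :
  energy r (push deg) (push deg) = 8 * Q ^+ 2 * mul_degree_kirchhoff R G.
Proof.
have -> : 8 * Q ^+ 2 * mul_degree_kirchhoff R G =
  4 * Q ^+ 2 * (2 * mul_degree_kirchhoff R G) by ring.
rewrite energyE (mul_degree_kirchhoffE rP) mulr_sumr; apply: eq_bigr => x _.
rewrite mulr_sumr; apply: eq_bigr => y _; rewrite !push_deg; ring.
Qed.

Lemma energy_deg_one :
  energy r (push deg) (push one) =
  2 * Q * (add_degree_kirchhoff R G + Q * mul_degree_kirchhoff R G).
Proof.
have -> : 2 * Q * (add_degree_kirchhoff R G + Q * mul_degree_kirchhoff R G) =
  2 * Q * add_degree_kirchhoff R G
  + Q ^+ 2 * (2 * mul_degree_kirchhoff R G) by ring.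
rewrite energyE (mul_degree_kirchhoffE rP) (add_degree_kirchhoffE rP).
rewrite !mulr_sumr -big_split; apply: eq_bigr => x _ /=.
rewrite !mulr_sumr -big_split; apply: eq_bigr => y _ /=.
by rewrite push_deg push_one; field.
Qed.

Lemma energy_one_one :
  energy r (push one) (push one) =
  2 * kirchhoff R G + Q * add_degree_kirchhoff R G
  + Q ^+ 2 / 2 * mul_degree_kirchhoff R G.
Proof.
have [rC _ _] := rP.
have addE : add_degree_kirchhoff R G = \sum_x \sum_y (degree y)%:R * r x y.
  rewrite (add_degree_kirchhoffE rP) exchange_big /=.
  by apply: eq_bigr => x _; apply: eq_bigr => y _; rewrite (rC y x).
have -> : 2 * kirchhoff R G + Q * add_degree_kirchhoff R G
  + Q ^+ 2 / 2 * mul_degree_kirchhoff R G =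
  2 * kirchhoff R G + Q / 2 * (add_degree_kirchhoff R G)
  + Q / 2 * (add_degree_kirchhoff R G)
  + Q ^+ 2 / 4 * (2 * mul_degree_kirchhoff R G) by field.
rewrite {1}addE energyE (mul_degree_kirchhoffE rP) (add_degree_kirchhoffE rP).
rewrite (kirchhoffE rP).
rewrite !mulr_sumr -!big_split; apply: eq_bigr => x _ /=.
rewrite !mulr_sumr -!big_split; apply: eq_bigr => y _ /=.
by rewrite !push_one; field.
Qed.

Let kP := subdivision_kernelP rP q0.

Lemma mul_degree_kirchhoff_subdivision :
  mul_degree_kirchhoff R H =
  4 * Q ^+ 2 * m ^+ 2 - 2 * Q * m - 4 * Q * m * (n - 1)
  + 8 * Q * mul_degree_kirchhoff R G.
Proof.
have two : (2 : R) != 0 by rewrite pnatr_eq0.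
apply: (mulfI two); rewrite (mul_degree_kirchhoffE kP).
rewrite (weighted_kernel_sum r deg deg) energy_deg_deg total_deg.
rewrite (half_path_sum (c := 2)); last by move=> e a; rewrite degree_new.
rewrite (self_energy_sum (c := 2)); last by move=> e a; rewrite degree_new.
rewrite (half_path_sum (alpha := fun x => deg x * deg x) (c := 4)); last first.
  by move=> e a; rewrite degree_new; ring.
by field.
Qed.

Lemma add_degree_kirchhoff_subdivision :
  add_degree_kirchhoff R H =
  Q * m * (n + Q * m) + 2 * Q ^+ 2 * m ^+ 2 - 2 * Q * m
  - (n + Q * m) * (n - 1) - 2 * Q * m * (n - 1)
  + 4 * add_degree_kirchhoff R G + 4 * Q * mul_degree_kirchhoff R G.
Proof.
rewrite (add_degree_kirchhoffE kP).
transitivity (\sum_(x : H) \sum_(y : H)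
    deg x * one y * subdivision_kernel r x y).
  by apply: eq_bigr => x _; apply: eq_bigr => y _; rewrite mulr1.
rewrite (weighted_kernel_sum r deg one) energy_deg_one total_deg total_one.
rewrite (half_path_sum (alpha := deg) (c := 2)); last first.
  by move=> e a; rewrite degree_new.
rewrite (half_path_sum (alpha := one) (c := 1)) //.
rewrite (self_energy_sum (alpha := deg) (c := 2)); last first.
  by move=> e a; rewrite degree_new.
rewrite (self_energy_sum (alpha := one) (c := 1)) //.
rewrite (half_path_sum (alpha := fun x => deg x * 1) (c := 2)); last first.
  by move=> e a; rewrite degree_new; ring.
by field.
Qed.

Lemma kirchhoff_subdivision :
  kirchhoff R H =
  (Q * m * (n + Q * m) - Q * m - (n + Q * m) * (n - 1)) / 2
  + 2 / Q * kirchhoff R G + add_degree_kirchhoff R G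
  + Q / 2 * mul_degree_kirchhoff R G.
Proof.
have two : (2 : R) != 0 by rewrite pnatr_eq0.
apply: (mulfI two); rewrite (kirchhoffE kP).
transitivity (\sum_(x : H) \sum_(y : H)
    one x * one y * subdivision_kernel r x y).
  by apply: eq_bigr => x _; apply: eq_bigr => y _; rewrite !mul1r.
rewrite (weighted_kernel_sum r one one) energy_one_one total_one.
rewrite !(half_path_sum (alpha := one) (c := 1)) //.
rewrite (self_energy_sum (alpha := one) (c := 1)) //.
rewrite (half_path_sum (alpha := fun x => 1 * 1) (c := 1)); last first.
  by move=> e a; rewrite mulr1.
by field.
Qed.

End Indices.

(** * Hierarchical lattices *)

Definition single_edge_kernel (R : realType) (x y : single_edge) : R :=
  (x != y)%:R.

Lemma single_edge_kernelP (R : realType) :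
  resistance_kernel (single_edge_kernel R).
Proof.
split=> [x y|x|]; rewrite /single_edge_kernel; first by rewrite eq_sym.
  by rewrite eqxx.
exists (fun=> 1) => x y; rewrite /laplacian big_mkcond big_bool /=.
by rewrite /single_edge_adj; case: x; case: y => /=; ring.
Qed.

Lemma degree_single_edge (x : single_edge) : degree x = 1%N.
Proof.
rewrite /degree -sum1_card big_mkcond big_bool /=.
by rewrite !inE /= /single_edge_adj; case: x.
Qed.

Lemma nb_edges_single_edge (R : realType) : (nb_edges single_edge)%:R = 1 :> R.
Proof.
have two : (2 : R) != 0 by rewrite pnatr_eq0.
apply: (mulfI two); rewrite -handshake big_bool !degree_single_edge.
by rewrite mulr1.
Qed.

Lemma degree_hierarchical_lattice (R : realType) (q k : nat)
    (x : hierarchical_lattice q k) : (0 < q)%N -> (0 < degree x)%N.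
Proof.
move=> q0; elim: k x => [x|k IH] /=; first by rewrite degree_single_edge.
case=> [u|[e a]]; rewrite -(ltr0n R).
  by rewrite degree_old mulr_gt0 ?ltr0n.
by rewrite degree_new.
Qed.

(** Only the existence of a kernel is recorded: its values enter the indices
    through the recurrences alone. *)
Lemma hierarchical_lattice_kernel (R : realType) (q k : nat) : (0 < q)%N ->
  exists r : hierarchical_lattice q k -> hierarchical_lattice q k -> R,
    resistance_kernel r.
Proof.
move=> q0; elim: k => [|k [r rP]].
  by exists (single_edge_kernel R); apply: single_edge_kernelP.
by eexists; apply: (subdivision_kernelP rP q0).
Qed.

Lemma nb_edges_hierarchical_lattice (R : realType) (q k : nat) :
  (nb_edges (hierarchical_lattice q k))%:R = (2 * q%:R) ^+ k :> R.
Proof.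
elim: k => [|k IH]; first exact: nb_edges_single_edge.
by rewrite exprS -IH; apply: nb_edges_subdivision.
Qed.

Lemma card_hierarchical_lattice (R : realType) (q k : nat) : (1 < q)%N ->
  #|hierarchical_lattice q k|%:R =
  2 + q%:R * ((2 * q%:R) ^+ k - 1) / (2 * q%:R - 1) :> R.
Proof.
move=> q1; have D0 : 2 * q%:R - 1 != 0 :> R.
  by rewrite gt_eqF // subr_gt0 -natrM ltr1n; case: q q1 => [|[]].
elim: k => [|k IH]; first by rewrite card_bool; field.
rewrite (card_subdivision R q (hierarchical_lattice q k)) IH.
rewrite nb_edges_hierarchical_lattice exprS; field.
exact: D0.
Qed.

Lemma card_hierarchical_lattice_gt0 (q k : nat) :
  (0 < #|hierarchical_lattice q k|)%N.
Proof.
elim: k => [|k IH]; first by rewrite card_bool.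
by rewrite card_sum ltn_addr.
Qed.

Section Recurrences.
Variables (R : realType) (q k : nat).
Hypothesis q1 : (1 < q)%N.
Local Notation Q := (q%:R : R).
Local Notation H k := (hierarchical_lattice q k).
Local Notation n := (2 + Q * ((2 * Q) ^+ k - 1) / (2 * Q - 1)).
Local Notation m := ((2 * Q) ^+ k).

Lemma kirchhoff_recurrences :
  [/\ mul_degree_kirchhoff R (H k.+1) =
        4 * Q ^+ 2 * m ^+ 2 - 2 * Q * m - 4 * Q * m * (n - 1)
        + 8 * Q * mul_degree_kirchhoff R (H k),
      add_degree_kirchhoff R (H k.+1) =
        Q * m * (n + Q * m) + 2 * Q ^+ 2 * m ^+ 2 - 2 * Q * m
        - (n + Q * m) * (n - 1) - 2 * Q * m * (n - 1)
        + 4 * add_degree_kirchhoff R (H k)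
        + 4 * Q * mul_degree_kirchhoff R (H k)
    & kirchhoff R (H k.+1) =
        (Q * m * (n + Q * m) - Q * m - (n + Q * m) * (n - 1)) / 2
        + 2 / Q * kirchhoff R (H k) + add_degree_kirchhoff R (H k)
        + Q / 2 * mul_degree_kirchhoff R (H k)].
Proof.
have q0 : (0 < q)%N := ltnW q1.
have [r rP] := hierarchical_lattice_kernel R k q0.
have G0 := card_hierarchical_lattice_gt0 q k.
rewrite -(card_hierarchical_lattice R k q1).
rewrite -(nb_edges_hierarchical_lattice R q k).
split.
- exact: (mul_degree_kirchhoff_subdivision q0 rP G0).
- exact: (add_degree_kirchhoff_subdivision q0 rP G0).
- exact: (kirchhoff_subdivision q0 rP G0).
Qed.

End Recurrences.

Lemma kirchhoff_single_edge (R : realType) :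
  [/\ mul_degree_kirchhoff R single_edge = 1,
      add_degree_kirchhoff R single_edge = 2 & kirchhoff R single_edge = 1].
Proof.
have rP := single_edge_kernelP R; have two : (2 : R) != 0 by rewrite pnatr_eq0.
split; [apply: (mulfI two)| |apply: (mulfI two)];
  rewrite ?(mul_degree_kirchhoffE rP) ?(add_degree_kirchhoffE rP)
    ?(kirchhoffE rP) !big_bool ?degree_single_edge /single_edge_kernel /=;
  by ring.
Qed.

Lemma hierarchical_indices_2 (R : realType) (k : nat) :
  let H := hierarchical_lattice 2 k in
  [/\ mul_degree_kirchhoff R H =
         ((6 * k%:R + 4) * 16 ^+ k + 5 * 4 ^+ k) / 9,
       add_degree_kirchhoff R H =
         4 * (k%:R + 1) * 16 ^+ k / 9 + 38 * 4 ^+ k / 27 + 4 / 27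
     & kirchhoff R H =
         2 * (3 * k%:R + 4) * 16 ^+ k / 81 + 38 * 4 ^+ k / 81
         + (35 - 6 * k%:R) / 81].
Proof.
have E16 j : 16 ^+ j = (4 ^+ j) ^+ 2 :> R.
  by rewrite -exprM mulnC exprM; congr (_ ^+ _); ring.
have E4 j : (2 * 2%:R) ^+ j = 4 ^+ j :> R by congr (_ ^+ _); ring.
elim: k => [|k [mulE addE kirE]] /=.
  have [-> -> ->] := kirchhoff_single_edge R.
  by split; rewrite !expr0; field.
have [-> -> ->] := kirchhoff_recurrences R k (isT : 1 < 2)%N.
rewrite mulE addE kirE E4 !E16 !exprS -natr1.
by split; field.
Qed.

Lemma denominators_neq0 (R : realType) (q : nat) : (2 < q)%N ->
  let Q : R := q%:R in
  [/\ Q != 0, Q - 2 != 0, Q + 1 != 0 & 2 * Q - 1 != 0].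
Proof.
move=> q2 Q; have Q2 : 2 < Q by rewrite ltr_nat.
by split; apply/eqP => Q0; lra.
Qed.

Lemma hierarchical_indices (R : realType) (q k : nat) :
  let H := hierarchical_lattice q k in
  let Q : R := q%:R in
  (2 < q)%N ->
  [/\ mul_degree_kirchhoff R H =
         2 * Q * (Q - 1) * (2 * Q) ^+ (2 * k) / ((Q - 2) * (2 * Q - 1))
         - 2 * Q * (8 * Q) ^+ k / (3 * (Q - 2))
         + (4 * Q - 3) * (2 * Q) ^+ k / (3 * (2 * Q - 1)),
       add_degree_kirchhoff R H =
         3 * Q ^+ 3 * (Q - 1) * (2 * Q) ^+ (2 * k)
           / ((Q - 2) * (Q + 1) * (2 * Q - 1) ^+ 2)
         - 2 * Q ^+ 2 * (8 * Q) ^+ k / (3 * (Q - 2) * (2 * Q - 1))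
         + Q * (4 * Q - 3) * (2 * Q) ^+ k / (3 * (2 * Q - 1) ^+ 2)
         + 2 * (3 * Q ^+ 2 + 2 * Q - 2) * 4 ^+ k
           / (3 * (Q + 1) * (2 * Q - 1))
         + (Q - 1) * (3 * Q - 2) / (3 * (2 * Q - 1) ^+ 2)
     & kirchhoff R H =
         Q ^+ 3 * (Q - 1) * (2 * Q) ^+ (2 * k)
           / (2 * (Q - 2) * (Q + 1) * (2 * Q - 1) ^+ 2)
         - Q ^+ 3 * (8 * Q) ^+ k / (6 * (Q - 2) * (2 * Q - 1) ^+ 2)
         + Q ^+ 2 * (4 * Q - 3) * (2 * Q) ^+ k
           / (6 * (Q + 1) * (2 * Q - 1) ^+ 2)
         + Q * (3 * Q ^+ 2 + 2 * Q - 2) * 4 ^+ k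
           / (3 * (Q + 1) * (2 * Q - 1) ^+ 2)
         + (5 * Q ^+ 4 - 9 * Q ^+ 3 - 5 * Q ^+ 2 + 12 * Q - 4)
           / (2 * (Q - 2) * (Q + 1) * (2 * Q - 1) ^+ 2) * (2 / Q) ^+ k
         - (Q - 1) * Q * (3 * Q - 2)
           / (6 * (Q - 2) * (2 * Q - 1) ^+ 2)].
Proof.
move=> H Q q2; rewrite {}/H.
have [d0 d1 d2 d3] := denominators_neq0 R q2; rewrite -/Q in d0 d1 d2 d3.
have E8 j : (8 * Q) ^+ j = 4 ^+ j * (2 * Q) ^+ j.
  by rewrite -exprMn; congr (_ ^+ _); ring.
have E2 j : (2 * Q) ^+ (2 * j) = ((2 * Q) ^+ j) ^+ 2 by rewrite mulnC exprM.
elim: k => [|k [mulE addE kirE]] /=.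
  have [-> -> ->] := kirchhoff_single_edge R.
  by split; rewrite muln0 !expr0; field; rewrite ?d0 ?d1 ?d2 ?d3.
have [-> -> ->] := kirchhoff_recurrences R k (ltnW q2).
rewrite mulE addE kirE -/Q !E8 !E2 !exprS.
set P := (2 * Q) ^+ k; set X := (4 : R) ^+ k; set Y := (2 / Q) ^+ k.
by split; field; rewrite ?d0 ?d1 ?d2 ?d3.
Qed.

(* The published Kirchhoff index for q = 2,
     2 (5 k + 7) 16^k / 135 + 38 4^k / 81 + (173 - 60 k) / 405,
   is false for k >= 2: it gives 649/9 at k = 2, where the index is 71.  The
   value stated below is the limit of the formula for q <> 2 as q tends to 2. *)
Theorem mainTheorem12 (R : realType) (q k : nat) (hq : (2 <= q)%N) :
  let H := hierarchical_lattice q k in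
  let Q : R := q%:R in
  (q = 2%N ->
   [/\ has_kemeny_constant H
         (((6 * k%:R + 4) * 4 ^+ k + 5) / 18 : R),
       mul_degree_kirchhoff R H =
         ((6 * k%:R + 4) * 16 ^+ k + 5 * 4 ^+ k) / 9,
       add_degree_kirchhoff R H =
         4 * (k%:R + 1) * 16 ^+ k / 9 + 38 * 4 ^+ k / 27 + 4 / 27
     & kirchhoff R H =
         2 * (3 * k%:R + 4) * 16 ^+ k / 81 + 38 * 4 ^+ k / 81
         + (35 - 6 * k%:R) / 81])
  /\
  (q <> 2%N ->
   [/\ has_kemeny_constant H
         (Q * (Q - 1) * (2 * Q) ^+ k / ((Q - 2) * (2 * Q - 1))
          - Q * 4 ^+ k / (3 * (Q - 2))
          + (4 * Q - 3) / (6 * (2 * Q - 1))),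
       mul_degree_kirchhoff R H =
         2 * Q * (Q - 1) * (2 * Q) ^+ (2 * k) / ((Q - 2) * (2 * Q - 1))
         - 2 * Q * (8 * Q) ^+ k / (3 * (Q - 2))
         + (4 * Q - 3) * (2 * Q) ^+ k / (3 * (2 * Q - 1)),
       add_degree_kirchhoff R H =
         3 * Q ^+ 3 * (Q - 1) * (2 * Q) ^+ (2 * k)
           / ((Q - 2) * (Q + 1) * (2 * Q - 1) ^+ 2)
         - 2 * Q ^+ 2 * (8 * Q) ^+ k / (3 * (Q - 2) * (2 * Q - 1))
         + Q * (4 * Q - 3) * (2 * Q) ^+ k / (3 * (2 * Q - 1) ^+ 2)
         + 2 * (3 * Q ^+ 2 + 2 * Q - 2) * 4 ^+ k
           / (3 * (Q + 1) * (2 * Q - 1))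
         + (Q - 1) * (3 * Q - 2) / (3 * (2 * Q - 1) ^+ 2)
     & kirchhoff R H =
         Q ^+ 3 * (Q - 1) * (2 * Q) ^+ (2 * k)
           / (2 * (Q - 2) * (Q + 1) * (2 * Q - 1) ^+ 2)
         - Q ^+ 3 * (8 * Q) ^+ k / (6 * (Q - 2) * (2 * Q - 1) ^+ 2)
         + Q ^+ 2 * (4 * Q - 3) * (2 * Q) ^+ k
           / (6 * (Q + 1) * (2 * Q - 1) ^+ 2)
         + Q * (3 * Q ^+ 2 + 2 * Q - 2) * 4 ^+ k
           / (3 * (Q + 1) * (2 * Q - 1) ^+ 2)
         + (5 * Q ^+ 4 - 9 * Q ^+ 3 - 5 * Q ^+ 2 + 12 * Q - 4)
           / (2 * (Q - 2) * (Q + 1) * (2 * Q - 1) ^+ 2) * (2 / Q) ^+ k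
         - (Q - 1) * Q * (3 * Q - 2)
           / (6 * (Q - 2) * (2 * Q - 1) ^+ 2)]).
Proof.

have q0 : (0 < q)%N := ltnW hq.
move=> H Q.
have [r rP] := hierarchical_lattice_kernel R k q0.
have kemeny := kemeny_mul_degree_kirchhoff rP
  (fun x => degree_hierarchical_lattice R x q0).
rewrite nb_edges_hierarchical_lattice in kemeny.
split=> q2.
  have [mulE addE kirE] := hierarchical_indices_2 R k.
  rewrite {}/Q {}/H; move: r rP kemeny; rewrite q2 => r rP kemeny; split=> //.
  rewrite mulE in kemeny.
  suff <- : (((6 * k%:R + 4) * 16 ^+ k + 5 * 4 ^+ k) / 9) / (2 * (2 * 2) ^+ k)
    = ((6 * k%:R + 4) * 4 ^+ k + 5) / 18 :> R by [].
  have -> : 16 ^+ k = (4 ^+ k) ^+ 2 :> R.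
    by rewrite -exprM mulnC exprM; congr (_ ^+ _); ring.
  have -> : (2 * 2) ^+ k = 4 ^+ k :> R by congr (_ ^+ _); ring.
  have X0 : 4 ^+ k != 0 :> R by rewrite expf_neq0 // pnatr_eq0.
  by field.
have q3 : (2 < q)%N by rewrite ltn_neqAle eq_sym hq andbT; apply/eqP.
have [mulE addE kirE] := hierarchical_indices R k q3.
split=> //; rewrite {}mulE in kemeny.
move: kemeny; congr has_kemeny_constant.
have [d0 d1 _ d3] := denominators_neq0 R q3; rewrite -/Q in d0 d1 d3.
have P0 : (2 * Q) ^+ k != 0 by rewrite expf_neq0 // mulf_neq0 // pnatr_eq0.
have -> : (8 * Q) ^+ k = 4 ^+ k * (2 * Q) ^+ k.
  by rewrite -exprMn; congr (_ ^+ _); ring.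
rewrite -/Q mulnC exprM; move: P0; set P := (2 * Q) ^+ k => P0.
by field; rewrite ?P0 ?d0 ?d1 ?d3.
Qed.
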